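(* Let $(M,g)$ be the $4$-dimensional semi-Riemannian manifold with the interior black hole metric $$ds^2 = -\left(\frac{2\xi}{t} - 1\right)^{-1}dt^2 + \left(\frac{2\xi}{t} - 1\right)dz^2 + t^2\left(d\theta^2 + \sin^2 \theta\, d\phi^2\right),$$ where $\xi=\xi(t)$ is a smooth function of $t$. Put $$L_1 = \frac{\xi - t \dot{\xi}}{t^3},\qquad L_2 = \frac{6 \xi - 4t \dot{\xi} + t^2 \ddot{\xi}}{6 t^3},\qquad L_3 = \frac{2\xi + t^2 \ddot{\xi}}{2t^3}.$$ Then $(M,g)$ satisfies the following (identities whose coefficients are fractions with a $\xi$-dependent denominator, namely (x) and (xix), hold at the points where that denominator is non-zero): (i) $C \cdot K = W \cdot K$, $C \cdot K = W \cdot C$, $C \cdot C = W \cdot C$; (ii) $W \cdot K = W \cdot C$, $C \cdot K = C \cdot C$; (iii) $W \cdot K = C \cdot C$; (iv) $C \cdot W = W \cdot R$; (v) $R \cdot S = P \cdot S$, $C \cdot S = W \cdot S$; (vi) $L_3\, R \cdot K = L_1\, K \cdot C$; (vii) $R \cdot W - W \cdot R = L_5\, Q(g, R)$, with $L_5 = - \frac{2\dot{\xi} + t \ddot{\xi}}{6t^2} = \frac{r}{12}$; (viii) $C \cdot K - K \cdot C = L_6\, Q(g, C)$, with $L_6 = - \frac{2 \dot{\xi} + t \ddot{\xi}}{3t^2} = \frac{r}{6}$; (ix) $C \cdot R - Q(S, C) = L_7\, Q(g, C)$, with $L_7 = \frac{3 \xi + t \dot{\xi} + 2t^2 \ddot{\xi}}{3t^3}$;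 (x) $R \cdot R - Q(S, R) = L_8\, Q(g, C)$, with $L_8 = \frac{6\xi^2 - 4 t \xi \dot{\xi} - 2t^2 \dot{\xi}^2 + 4t^2 \xi \ddot{\xi}}{t^3(6 \xi - 4 t \dot{\xi} + t^2 \ddot{\xi})}$; (xi) $L_6 L_9\, R \cdot W + L_1 L_{10}\, Q(S, W) = L_1 L_{11}\, Q(S, R)$, with $L_9 = - 3t \left(6\dot{\xi}(\xi- t\dot{\xi})+t(t\dot{\xi}+3\xi)\ddot{\xi}\right)$, $L_{10} = 6\left(-t^2 \dot{\xi}^2+2 t \xi(t \ddot{\xi}-\dot{\xi})+3 \xi^2\right)$, $L_{11} = t^2\left(-t^2 \ddot{\xi}^2+2 \dot{\xi}^2+2t\dot{\xi} \ddot{\xi}\right)+6t\xi(t \ddot{\xi}-4 \dot{\xi})+18 \xi^2$; (xii) $L_3\, R \cdot K + L_{12}\, K \cdot R + L_3\, Q(S, K)=0$, with $L_{12} = \frac{-2\xi + 4 t \dot{\xi} + t^2 \ddot{\xi}}{2t^3}$; (xiii) $L_3 L_{13}\, R \cdot K - L^2_1 L_2\, K \cdot R + L_1 L_2 L_3\, Q(S, R) = 0$, with $L_{13} = \frac{3\xi^2 - 2 t \xi \dot{\xi} - t^2 \dot{\xi}^2 + 2t^2 \xi \ddot{\xi}}{3 t^6}$; (xiv) $L_2\, C \cdot W - L_7\, W \cdot C = L_2\, Q(S, C)$; (xv) $L_2 L_{14}\, C \cdot W - \frac{1}{18t^6}L_{11}\, W \cdot C = L^2_2\, Q(S, W)$,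 with $L_{14} = \frac{3\xi - 5t \dot{\xi} - t^2 \ddot{\xi}}{3t^3}$; (xvi) $L_{15}\, C \cdot K + L^2_2\, Q(S, K) = L_2 L_{16}\, Q(S, C)$, with $L_{15} = \frac{4t^2\dot{\xi}^2+4t^3\dot{\xi}\ddot{\xi}+t^4 \ddot{\xi}^2}{3t^6}$, $L_{16} = \frac{2\xi -4t \dot{\xi}-t^2 \ddot{\xi}}{2t^3}$; (xvii) $\frac{1}{18t^6} L_3 L_{11}\, W \cdot K - L^2_2 L_{14}\, K \cdot W + L^2_2 L_3\, Q(S, W) = 0$; (xviii) $L_1 L_3\, W \cdot K + L_2 L_{12}\, K \cdot W + L_2 L_3\, Q(S, K)=0$; (xix) the Roter type condition $R = \frac{\phi}{2}S\wedge S + \mu\, g\wedge S + \eta\, G$, where $$\phi = - \frac{ 6 t \xi - 4 t^2 \dot{\xi} + t^3 \ddot{\xi}}{(t \ddot{\xi} - 2 \dot{\xi})^2},\qquad \mu = -\frac{6 \xi \dot{\xi} - 6 t \dot{\xi}^2 + 3 t \xi \ddot{\xi} + t^2 \dot{\xi} \ddot{\xi}}{t(t \ddot{\xi} - 2 \dot{\xi})^2},\qquad \eta = -\frac{2(4 \xi \dot{\xi}^2 - 4 t \dot{\xi}^3 + 2 t \xi \dot{\xi} \ddot{\xi} + t^2 \xi \ddot{\xi}^2)}{t^3(t \ddot{\xi} - 2 \dot{\xi})^2}$$ (here $\phi$ is a coefficient function, not the coordinate).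
   Context: Coordinates are $(t,z,\theta,\phi)$, with $t>0$ in an open interval on which $\frac{2\xi(t)}{t}-1>0$ (so $g$ has signature $(-+++)$), and $\theta\in(0,\pi)$. $\dot{\xi}=\frac{d\xi}{dt}$, $\ddot{\xi}=\frac{d^2\xi}{dt^2}$. Let $n=\dim M=4$ and let $\nabla$ be the Levi-Civita connection of $g$. For a $(0,2)$-tensor $A$ define the endomorphism $(X\wedge_A Y)U = A(Y,U)X-A(X,U)Y$. For $(0,2)$-tensors $A,B$ the Kulkarni-Nomizu product is $(A\wedge B)(X_1,X_2,X,Y)=A(X_1,Y)B(X_2,X)+A(X_2,X)B(X_1,Y)-A(X_1,X)B(X_2,Y)-A(X_2,Y)B(X_1,X)$, and $G=\frac12 g\wedge g$. Sign convention: the curvature endomorphism is $\mathcal{R}(X,Y)U = \nabla_{[X,Y]}U-[\nabla_X,\nabla_Y]U$. The Ricci tensor is $S(X,Y)=\mathrm{tr}\{U\mapsto \mathcal{R}(U,X)Y\}$, the Ricci operator $\mathcal{L}$ is given by $g(\mathcal{L}X,Y)=S(X,Y)$, and the scalar curvature is $r=\mathrm{tr}\,\mathcal{L}$. Further endomorphisms: $\mathcal{C}(X,Y) = \mathcal{R}(X,Y)-\frac{1}{n-2}\left(X\wedge_g \mathcal{L} Y + \mathcal{L} X\wedge_g Y - \frac{r}{n-1}X\wedge_g Y\right)$, $\mathcal{P}(X,Y) = \mathcal{R}(X,Y)-\frac{1}{n-1}X\wedge_S Y$, $\mathcal{W}(X,Y) = \mathcal{R}(X,Y)-\frac{r}{n(n-1)}X\wedge_g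 Y$, $\mathcal{K}(X,Y) = \mathcal{R}(X,Y)-\frac{1}{n-2}\left(X\wedge_g \mathcal{L} Y + \mathcal{L} X\wedge_g Y\right)$. For $\mathcal{D}\in\{\mathcal{R},\mathcal{C},\mathcal{P},\mathcal{W},\mathcal{K}\}$ the corresponding $(0,4)$-tensor $D\in\{R,C,P,W,K\}$ is $D(X_1,X_2,X_3,X_4)=g(\mathcal{D}(X_1,X_2)X_3,X_4)$. For a $(0,k)$-tensor $T$, $k\ge1$, define the $(0,k+2)$-tensors $(D\cdot T)(X_1,\ldots,X_k;X,Y) = -T(\mathcal{D}(X,Y)X_1,X_2,\ldots,X_k)-\cdots-T(X_1,\ldots,X_{k-1},\mathcal{D}(X,Y)X_k)$, and, for a symmetric $(0,2)$-tensor $A$, $Q(A,T)(X_1,\ldots,X_k;X,Y) = -T((X\wedge_A Y)X_1,X_2,\ldots,X_k)-\cdots-T(X_1,\ldots,X_{k-1},(X\wedge_A Y)X_k)$. *)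

(* Defs.v *)
From Stdlib Require Export Reals Lra.
From Coquelicot Require Export Coquelicot.

Open Scope R_scope.

(** * Tensor calculus on a coordinate chart of dimension 4 *)

Inductive coord := c_t | c_z | c_theta | c_phi.

Definition coord_eqb (i j : coord) : bool :=
  match i, j with
  | c_t, c_t | c_z, c_z | c_theta, c_theta | c_phi, c_phi => true
  | _, _ => false
  end.

(** Tangent vectors are given by their components in the coordinate frame. *)
Definition point := coord -> R.
Definition vec := coord -> R.
Definition vfield := point -> vec.

Definition sum4 (f : coord -> R) : R := f c_t + f c_z + f c_theta + f c_phi.
Definition basis (i : coord) : vec := fun j => if coord_eqb i j then 1 else 0.
Definition trace (E : vec -> vec) : R := sum4 (fun i => E (basis i) i).
Definition dim : R := 4.

Definition update (p : point) (i : coord) (s : R) : point :=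
  fun j => if coord_eqb i j then s else p j.

Definition partial (i : coord) (f : point -> R) (p : point) : R :=
  Derive (fun s => f (update p i s)) (p i).

(** [(0,k)]-tensors at a point, as curried functions of [k] tangent vectors;
    multilinearity is not built into the type. *)
Fixpoint tensor (k : nat) : Type :=
  match k with
  | O => R
  | S k' => vec -> tensor k'
  end.

Fixpoint tzero (k : nat) : tensor k :=
  match k with
  | O => 0
  | S k' => fun _ => tzero k'
  end.

Fixpoint tplus (k : nat) : tensor k -> tensor k -> tensor k :=
  match k with
  | O => fun a b => a + b
  | S k' => fun A B x => tplus k' (A x) (B x)
  end.

Fixpoint tscale (k : nat) (c : R) : tensor k -> tensor k :=
  match k with
  | O => fun a => c * a
  | S k' => fun A x => tscale k' c (A x)
  end.

Arguments tzero {k}.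
Arguments tplus {k} A B.
Arguments tscale {k} c A.

Definition tminus {k : nat} (A B : tensor k) : tensor k :=
  tplus A (tscale (-1) B).

Declare Scope tensor_scope.
Delimit Scope tensor_scope with T.
Arguments tplus {k} (A B)%_T.
Arguments tscale {k} c%_R A%_T.
Arguments tminus {k} (A B)%_T.
Notation "0" := tzero : tensor_scope.
Infix "+" := tplus : tensor_scope.
Infix "-" := tminus : tensor_scope.
Infix "*" := tscale : tensor_scope.

(** [act E T] maps [X_1, ..., X_k] to
    [- T(E X_1, X_2, ..., X_k) - ... - T(X_1, ..., X_{k-1}, E X_k)]. *)
Fixpoint act (k : nat) (E : vec -> vec) : tensor k -> tensor k :=
  match k with
  | O => fun _ => 0
  | S k' => fun T x => (tscale (-1) (T (E x)) + act k' E (T x))%T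
  end.

(** Moves the two arguments [X, Y] behind the other [k]. *)
Fixpoint last2 (k : nat) : (vec -> vec -> tensor k) -> tensor (k + 2) :=
  match k with
  | O => fun F => F
  | S k' => fun F x => last2 k' (fun X Y => F X Y x)
  end.

Definition dot {k : nat} (D : vec -> vec -> vec -> vec) (T : tensor k) :
  tensor (k + 2) := last2 k (fun X Y => act k (D X Y) T).

Infix "·" := dot (at level 38, no associativity) : tensor_scope.

Definition wedge (A : tensor 2) (X Y U : vec) : vec :=
  fun k => A Y U * X k - A X U * Y k.

Definition Q {k : nat} (A : tensor 2) (T : tensor k) : tensor (k + 2) :=
  dot (wedge A) T.

Definition kulkarni_nomizu (A B : tensor 2) : tensor 4 :=
  fun X1 X2 X Y =>
    A X1 Y * B X2 X + A X2 X * B X1 Y - A X1 X * B X2 Y - A X2 Y * B X1 X.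

Infix "∧" := kulkarni_nomizu (at level 38, no associativity) : tensor_scope.

(** * Semi-Riemannian geometry on the chart *)

(** The components [g_ij] of the metric and [g^ij] of its inverse. *)
Record metric := Metric {
  lower : point -> coord -> coord -> R;
  upper : point -> coord -> coord -> R }.

Definition is_inverse_at (M : metric) (p : point) : Prop :=
  forall i j, sum4 (fun k => lower M p i k * upper M p k j) = basis i j.

Definition gten (M : metric) (p : point) : tensor 2 :=
  fun x y => sum4 (fun i => sum4 (fun j => lower M p i j * x i * y j)).

Definition Gten (M : metric) (p : point) : tensor 4 :=
  (/ 2 * (gten M p ∧ gten M p))%T.

Definition christoffel (M : metric) (p : point) (k i j : coord) : R :=
  / 2 * sum4 (fun l => upper M p k l *
    (partial i (fun q => lower M q j l) p + partial j (fun q => lower M q i l) p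
     - partial l (fun q => lower M q i j) p)).

(** The Levi-Civita connection. *)
Definition nabla (M : metric) (X Y : vfield) : vfield := fun p k =>
  sum4 (fun i => X p i * partial i (fun q => Y q k) p)
  + sum4 (fun i => sum4 (fun j => christoffel M p k i j * X p i * Y p j)).

Definition bracket (X Y : vfield) : vfield := fun p k =>
  sum4 (fun i => X p i * partial i (fun q => Y q k) p
                 - Y p i * partial i (fun q => X q k) p).

Definition curvature (M : metric) (X Y U : vfield) : vfield := fun p k =>
  nabla M (bracket X Y) U p k
  - (nabla M X (nabla M Y U) p k - nabla M Y (nabla M X U) p k).

Definition const_field (x : vec) : vfield := fun _ => x.

(** The curvature is tensorial, so its value on tangent vectors may be
    computed with the extensions having constant components. *)
Definition opR (M : metric) (p : point) (x y u : vec) : vec :=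
  curvature M (const_field x) (const_field y) (const_field u) p.

Definition ricci (M : metric) (p : point) : tensor 2 :=
  fun x y => trace (fun u => opR M p u x y).

Definition ricci_op (M : metric) (p : point) (x : vec) : vec :=
  fun k => sum4 (fun l => upper M p k l * ricci M p x (basis l)).

Definition scalar (M : metric) (p : point) : R := trace (ricci_op M p).

Definition opC (M : metric) (p : point) (x y u : vec) : vec := fun k =>
  let g := gten M p in let L := ricci_op M p in
  opR M p x y u k
  - / (dim - 2) * (wedge g x (L y) u k + wedge g (L x) y u k
                   - scalar M p / (dim - 1) * wedge g x y u k).

Definition opP (M : metric) (p : point) (x y u : vec) : vec := fun k =>
  opR M p x y u k - / (dim - 1) * wedge (ricci M p) x y u k.

Definition opW (M : metric) (p : point) (x y u : vec) : vec := fun k =>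
  opR M p x y u k
  - scalar M p / (dim * (dim - 1)) * wedge (gten M p) x y u k.

Definition opK (M : metric) (p : point) (x y u : vec) : vec := fun k =>
  let g := gten M p in let L := ricci_op M p in
  opR M p x y u k
  - / (dim - 2) * (wedge g x (L y) u k + wedge g (L x) y u k).

Definition lower4 (M : metric) (p : point) (D : vec -> vec -> vec -> vec) :
  tensor 4 := fun x1 x2 x3 x4 => gten M p (D x1 x2 x3) x4.

(** [christoffel] is the torsion-free metric connection, and [ricci_op]
    represents the Ricci tensor. *)

Lemma nabla_torsion_free (M : metric) (X Y : vfield) (p : point) (k : coord) :
  (forall q i j, lower M q i j = lower M q j i) ->
  nabla M X Y p k - nabla M Y X p k = bracket X Y p k.
Proof.
intros Hsym.
assert (HG : forall i j, christoffel M p k i j = christoffel M p k j i).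
{ assert (HP : forall l i j, partial l (fun q => lower M q i j) p
                           = partial l (fun q => lower M q j i) p)
    by (intros; apply Derive_ext; intros; apply Hsym).
  intros i j; unfold christoffel, sum4.
  rewrite (HP c_t i j), (HP c_z i j), (HP c_theta i j), (HP c_phi i j); ring. }
unfold nabla, bracket, sum4.
rewrite (HG c_z c_t), (HG c_theta c_t), (HG c_phi c_t), (HG c_theta c_z),
  (HG c_phi c_z), (HG c_phi c_theta); ring.
Qed.

Lemma nabla_metric (M : metric) (p : point) (i j k : coord) :
  (forall q a b, lower M q a b = lower M q b a) -> is_inverse_at M p ->
  partial i (fun q => lower M q j k) p
  = gten M p (nabla M (const_field (basis i)) (const_field (basis j)) p) (basis k)
  + gten M p (basis j) (nabla M (const_field (basis i)) (const_field (basis k)) p).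
Proof.
intros Hsym Hinv.
assert (HP : forall l a b, partial l (fun q => lower M q a b) p
                         = partial l (fun q => lower M q b a) p)
  by (intros; apply Derive_ext; intros; apply Hsym).
assert (HN : forall a b m,
  nabla M (const_field (basis a)) (const_field (basis b)) p m
  = christoffel M p m a b).
{ intros a b m; unfold nabla, const_field, partial.
  unfold sum4 at 1; rewrite !Derive_const.
  destruct a, b; unfold sum4, basis; simpl; ring. }
assert (HL : forall a b d,
  sum4 (fun m => lower M p d m * christoffel M p m a b)
  = / 2 * (partial a (fun q => lower M q b d) p
           + partial b (fun q => lower M q a d) p
           - partial d (fun q => lower M q a b) p)).
{ intros a b d.
  set (v := fun l => partial a (fun q => lower M q b l) p
           + partial b (fun q => lower M q a l) p
           - partial l (fun q => lower M q a b) p).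
  transitivity (/ 2 * sum4 (fun l =>
    sum4 (fun m => lower M p d m * upper M p m l) * v l)).
  - unfold christoffel, v, sum4; ring.
  - change (/ 2 * sum4 (fun l =>
      sum4 (fun m => lower M p d m * upper M p m l) * v l) = / 2 * v d).
    unfold sum4 at 1; rewrite !Hinv; destruct d; unfold basis; simpl; ring. }
assert (HA : forall x m, gten M p (basis m) x
                         = sum4 (fun b => lower M p m b * x b)).
{ intros x m; destruct m; unfold gten, sum4, basis; simpl; ring. }
assert (HB : forall x m, gten M p x (basis m) = gten M p (basis m) x).
{ intros x m; rewrite HA; destruct m; unfold gten, sum4, basis; simpl;
  rewrite ?(Hsym p c_z c_t), ?(Hsym p c_theta c_t), ?(Hsym p c_phi c_t),
    ?(Hsym p c_theta c_z), ?(Hsym p c_phi c_z), ?(Hsym p c_phi c_theta); ring. }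
rewrite HB, !HA.
unfold sum4; rewrite !HN.
pose proof (HL i j k) as H1; pose proof (HL i k j) as H2.
unfold sum4 in H1, H2; rewrite H1, H2.
rewrite (HP i k j), (HP j i k), (HP k i j), (HP j k i), (HP k j i); field.
Qed.

Lemma gten_ricci_op (M : metric) (p : point) (x : vec) (l : coord) :
  (forall q a b, lower M q a b = lower M q b a) -> is_inverse_at M p ->
  gten M p (ricci_op M p x) (basis l) = ricci M p x (basis l).
Proof.
intros Hsym Hinv.
transitivity (sum4 (fun m => sum4 (fun k => lower M p l k * upper M p k m)
                             * ricci M p x (basis m))).
- unfold gten, ricci_op.
  generalize (fun m => ricci M p x (basis m)); intros f.
  destruct l; unfold sum4; simpl;
  rewrite ?(Hsym p c_z c_t), ?(Hsym p c_theta c_t), ?(Hsym p c_phi c_t),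
    ?(Hsym p c_theta c_z), ?(Hsym p c_phi c_z), ?(Hsym p c_phi c_theta);
  unfold basis; simpl; ring.
- unfold sum4 at 1; rewrite !Hinv; destruct l; unfold basis at 1 3 5 7; simpl; ring.
Qed.

(** * The interior black hole metric *)

Definition bh_diag (xi : R -> R) (p : point) (i : coord) : R :=
  let t := p c_t in
  match i with
  | c_t => - / (2 * xi t / t - 1)
  | c_z => 2 * xi t / t - 1
  | c_theta => t ^ 2
  | c_phi => t ^ 2 * sin (p c_theta) ^ 2
  end.

Definition bh_metric (xi : R -> R) : metric := {|
  lower := fun p i j => if coord_eqb i j then bh_diag xi p i else 0;
  upper := fun p i j => if coord_eqb i j then / bh_diag xi p i else 0 |}.

Definition in_interval (a b : Rbar) (t : R) : Prop :=
  Rbar_lt a t /\ Rbar_lt t b.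

Definition in_chart (a b : Rbar) (p : point) : Prop :=
  in_interval a b (p c_t) /\ 0 < p c_theta < PI.

Lemma bh_metric_inverse (xi : R -> R) (p : point) :
  0 < p c_t -> 0 < 2 * xi (p c_t) / p c_t - 1 -> 0 < p c_theta < PI ->
  is_inverse_at (bh_metric xi) p.
Proof.
intros Ht Hx Hth i j.
assert (Hs : sin (p c_theta) <> 0)
  by (apply Rgt_not_eq, sin_gt_0; apply Hth).
assert (Hd : forall k, bh_diag xi p k <> 0).
{ intros k; destruct k; unfold bh_diag.
  - apply Ropp_neq_0_compat, Rinv_neq_0_compat; lra.
  - lra.
  - apply pow_nonzero; lra.
  - apply Rmult_integral_contrapositive; split; apply pow_nonzero; lra. }
unfold sum4, bh_metric, basis; cbn -[bh_diag].
destruct i, j; cbn -[bh_diag]; rewrite ?Rinv_r by apply Hd; ring.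
Qed.

(* Main.v *)
Require Import Defs.
From Stdlib Require Import FunctionalExtensionality.

(** The metric splits orthogonally as [g = h + k], with [h] on the [(t, z)]-plane and
    [k] on the [(theta, phi)]-sphere, and its curvature is
    [R = a/2 h∧h + b h∧k + c/2 k∧k], so that [S], [C], [W] and [K] are determined by
    [h], [k] and scalars. An endomorphism built from [h] and [k] annihilates [h] and [k]
    except through the two parts of it that exchange the blocks, and these two parts
    send [h] and [k] to multiples of one and the same tensor [τ]. So every [D · T] and
    [Q A T] with [T] a curvature tensor of the above shape lies in the span of [h∧τ]
    and [k∧τ], and each identity amounts to two identities between rational functions
    of [t] and the derivatives of [xi]. *)

(** * Forms, operators and curvature tensors adapted to a 2+2 splitting *)

Definition first_block (i : coord) : bool :=
  match i with c_t | c_z => true | _ => false end.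

Definition form1 (w : coord -> R) (x y : vec) : R :=
  w c_t * x c_t * y c_t + w c_z * x c_z * y c_z.

Definition form2 (w : coord -> R) (x y : vec) : R :=
  w c_theta * x c_theta * y c_theta + w c_phi * x c_phi * y c_phi.

Definition block_form (w : coord -> R) (a b : R) : tensor 2 :=
  fun x y => a * form1 w x y + b * form2 w x y.

(** Curvature operators have [b = c]; the wedge product of a form that is not a multiple
    of the metric, which occurs in [Q S], does not. *)
Definition block_op (w : coord -> R) (a b c d : R) (x y u : vec) : vec :=
  fun i => (if first_block i then a else c) * (form1 w y u * x i - form1 w x u * y i)
         + (if first_block i then b else d) * (form2 w y u * x i - form2 w x u * y i).

Definition block_curv (w : coord -> R) (a b c : R) : tensor 4 :=
  (a / 2 * (block_form w 1 0 ∧ block_form w 1 0)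
   + b * (block_form w 1 0 ∧ block_form w 0 1)
   + c / 2 * (block_form w 0 1 ∧ block_form w 0 1))%T.

(** [Q k (h∧h/2)] and [Q k (h∧k)] are [h∧τ] and [k∧τ]. *)
Definition block_span (w : coord -> R) (a b : R) : tensor (4 + 2) :=
  (a * Q (block_form w 0 1) (block_curv w 1 0 0)
   + b * Q (block_form w 0 1) (block_curv w 0 1 0))%T.

Ltac tensor_ext :=
  repeat (let x := fresh "x" in apply functional_extensionality; intros x).

(** As rewriting rules, these turn the action of a block operator into a polynomial in the values of
    [h] and [k] on the arguments, so that [ring] or [field] concludes without expanding into
    components. *)
Lemma form1_op_l w a b c d x y u v :
  form1 w (block_op w a b c d x y u) v
  = a * (form1 w y u * form1 w x v - form1 w x u * form1 w y v)
    + b * (form2 w y u * form1 w x v - form2 w x u * form1 w y v).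
Proof. unfold form1 at 1; unfold block_op; simpl; unfold form1; ring. Qed.

Lemma form2_op_l w a b c d x y u v :
  form2 w (block_op w a b c d x y u) v
  = c * (form1 w y u * form2 w x v - form1 w x u * form2 w y v)
    + d * (form2 w y u * form2 w x v - form2 w x u * form2 w y v).
Proof. unfold form2 at 1; unfold block_op; simpl; unfold form2; ring. Qed.

Lemma form1_sym w x y : form1 w x y = form1 w y x.
Proof. unfold form1; ring. Qed.

Lemma form2_sym w x y : form2 w x y = form2 w y x.
Proof. unfold form2; ring. Qed.

(** The vectors [x] and [y] stay in the first slot, as in [form1_op_l], so that both slots produce
    the same atoms for [ring]. *)
Lemma form1_op_r w a b c d x y u v :
  form1 w v (block_op w a b c d x y u)
  = a * (form1 w y u * form1 w x v - form1 w x u * form1 w y v)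
    + b * (form2 w y u * form1 w x v - form2 w x u * form1 w y v).
Proof. rewrite form1_sym; apply form1_op_l. Qed.

Lemma form2_op_r w a b c d x y u v :
  form2 w v (block_op w a b c d x y u)
  = c * (form1 w y u * form2 w x v - form1 w x u * form2 w y v)
    + d * (form2 w y u * form2 w x v - form2 w x u * form2 w y v).
Proof. rewrite form2_sym; apply form2_op_l. Qed.

Ltac eval_tensor :=
  tensor_ext;
  cbv beta iota fix delta [dot last2 act tplus tminus tscale tzero Nat.add
    kulkarni_nomizu block_form block_curv block_span];
  repeat rewrite ?form1_op_l, ?form2_op_l, ?form1_op_r, ?form2_op_r.

Lemma wedge_block w a b : wedge (block_form w a b) = block_op w a b a b.
Proof.
tensor_ext; unfold wedge, block_form, block_op.
destruct (first_block _); ring.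
Qed.

Lemma kulkarni_nomizu_block w a b c d :
  (block_form w a b ∧ block_form w c d)%T
  = block_curv w (2 * a * c) (a * d + b * c) (2 * b * d).
Proof. eval_tensor; field. Qed.

(** The parts [a] and [d] are skew for [h] and [k] and cancel. With [τ = Q k h], the part [b] sends
    [h] to [b τ] and the part [c] sends [k] to [- c τ]. *)
Lemma dot_block_form w a b c d e f :
  (block_op w a b c d · block_form w e f)%T
  = ((b * e - c * f) * Q (block_form w 0 1) (block_form w 1 0))%T.
Proof.
unfold Q; rewrite wedge_block.
eval_tensor; ring.
Qed.

(** By the Leibniz rule [h∧h/2] gives [b h∧τ], [h∧k] gives [b k∧τ - c h∧τ], and [k∧k/2] gives
    [- c k∧τ]. In particular [G], where [e = f = g = 1], is annihilated as soon as [b = c]. *)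
Lemma dot_block_curv w a b c d e f g :
  (block_op w a b c d · block_curv w e f g)%T
  = block_span w (b * e - c * f) (b * f - c * g).
Proof.
unfold block_span, Q; rewrite wedge_block; eval_tensor; field.
Qed.

Lemma block_span_eq w a b c d : a = c -> b = d -> block_span w a b = block_span w c d.
Proof. now intros -> ->. Qed.

Lemma block_curv_eq w a b c a' b' c' :
  a = a' -> b = b' -> c = c' -> block_curv w a b c = block_curv w a' b' c'.
Proof. now intros -> -> ->. Qed.

Lemma block_span_plus w a b c d :
  (block_span w a b + block_span w c d)%T = block_span w (a + c) (b + d).
Proof. eval_tensor; ring. Qed.

Lemma block_span_scale w e a b : (e * block_span w a b)%T = block_span w (e * a) (e * b).
Proof. eval_tensor; ring. Qed.

Lemma block_span_minus w a b c d :
  (block_span w a b - block_span w c d)%T = block_span w (a - c) (b - d).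
Proof.
unfold tminus; rewrite block_span_scale, block_span_plus.
f_equal; ring.
Qed.

Lemma block_span_zero w : block_span w 0 0 = 0%T.
Proof. eval_tensor; ring. Qed.

Lemma block_curv_plus w a b c a' b' c' :
  (block_curv w a b c + block_curv w a' b' c')%T
  = block_curv w (a + a') (b + b') (c + c').
Proof. eval_tensor; field. Qed.

Lemma block_curv_scale w e a b c :
  (e * block_curv w a b c)%T = block_curv w (e * a) (e * b) (e * c).
Proof. eval_tensor; field. Qed.

Lemma gten_block M p w :
  (forall i j, lower M p i j = if coord_eqb i j then w i else 0) ->
  gten M p = block_form w 1 1.
Proof.
intros Hlow; tensor_ext; unfold gten, sum4, block_form, form1, form2.
rewrite !Hlow; simpl; ring.
Qed.

Lemma lower4_block M p w a b c :
  (forall i j, lower M p i j = if coord_eqb i j then w i else 0) ->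
  lower4 M p (block_op w a b b c) = block_curv w a b c.
Proof.
intros Hlow; tensor_ext; unfold lower4; rewrite (gten_block _ _ _ Hlow).
unfold block_curv, tplus, tscale, kulkarni_nomizu, block_form.
rewrite form1_op_l, form2_op_l; field.
Qed.

(** * Ricci tensor and derived operators of a block curvature operator *)

Section BlockCurvature.
Variables (M : metric) (p : point) (w : coord -> R) (a b c : R).
Hypothesis w_neq0 : forall i, w i <> 0.
Hypothesis lower_w : forall i j, lower M p i j = if coord_eqb i j then w i else 0.
Hypothesis upper_w : forall i j, upper M p i j = if coord_eqb i j then / w i else 0.
Hypothesis opR_block : opR M p = block_op w a b b c.

(** Each direction spans a plane with one direction of its own block and with two of the other. *)
Lemma ricci_block : ricci M p = block_form w (a + 2 * b) (2 * b + c).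
Proof.
tensor_ext; unfold ricci; rewrite opR_block.
unfold trace, sum4, block_op, block_form, form1, form2, basis; simpl; ring.
Qed.

Lemma ricci_op_block x :
  ricci_op M p x
  = fun i => (if first_block i then a + 2 * b else 2 * b + c) * x i.
Proof.
apply functional_extensionality; intros i; unfold ricci_op, sum4.
rewrite !upper_w, ricci_block; pose proof (w_neq0 i).
destruct i; simpl; unfold block_form, form1, form2, basis; simpl; field; assumption.
Qed.

Lemma scalar_block : scalar M p = 2 * a + 8 * b + 2 * c.
Proof.
unfold scalar, trace, sum4; rewrite !ricci_op_block; unfold basis; simpl; ring.
Qed.

Lemma opW_block :
  opW M p = block_op w (a - (a + 4 * b + c) / 6) (b - (a + 4 * b + c) / 6)
                       (b - (a + 4 * b + c) / 6) (c - (a + 4 * b + c) / 6).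
Proof.
tensor_ext; unfold opW.
rewrite opR_block, scalar_block, (gten_block _ _ _ lower_w), wedge_block.
unfold block_op, dim; destruct (first_block _); field.
Qed.

(** The subtracted wedge product is that of [S], so the two exchanging coefficients differ in
    general. In the theorem this operator acts only on [S], and [dot_block_form] covers that
    case. *)
Lemma opP_block :
  opP M p = block_op w (a - (a + 2 * b) / 3) (b - (2 * b + c) / 3)
                       (b - (a + 2 * b) / 3) (c - (2 * b + c) / 3).
Proof.
tensor_ext; unfold opP.
rewrite opR_block, ricci_block, wedge_block.
unfold block_op, dim; destruct (first_block _); field.
Qed.

Lemma opK_block :
  opK M p = block_op w (- 2 * b) (b - (a + 4 * b + c) / 2)
                       (b - (a + 4 * b + c) / 2) (- 2 * b).
Proof.
tensor_ext; unfold opK.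
rewrite opR_block, (gten_block _ _ _ lower_w), !wedge_block, !ricci_op_block.
unfold block_op, form1, form2, dim; destruct (first_block _) eqn:E; simpl; field.
Qed.

(** The exchanging coefficient equals that of [opW_block], so both operators act alike on block
    tensors. The difference with [opK_block] is a multiple of [wedge g], so the lowered tensors
    differ by a multiple of [G]. These two facts are behind (i) to (iii). *)
Lemma opC_block :
  opC M p = block_op w ((a - 2 * b + c) / 3) (- (a - 2 * b + c) / 6)
                       (- (a - 2 * b + c) / 6) ((a - 2 * b + c) / 3).
Proof.
tensor_ext; unfold opC.
rewrite opR_block, (gten_block _ _ _ lower_w), !wedge_block, !ricci_op_block,
  scalar_block.
unfold block_op, form1, form2, dim; destruct (first_block _) eqn:E; simpl; field.
Qed.
End BlockCurvature.

(** * Connection and curvature of the black hole metric *)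

Section BlackHole.
Variables (xi : R -> R) (a b : Rbar).
Hypothesis xi_smooth : forall (m : nat) (t : R), in_interval a b t -> ex_derive_n xi m t.
Hypothesis t_pos : forall t : R, in_interval a b t -> 0 < t.
Hypothesis signature : forall t : R, in_interval a b t -> 0 < 2 * xi t / t - 1.

Definition lapse (t : R) : R := 2 * xi t / t - 1.
Definition lapse' (t : R) : R := 2 * Derive xi t / t - 2 * xi t / t ^ 2.
Definition lapse'' (t : R) : R :=
  2 * Derive_n xi 2 t / t - 4 * Derive xi t / t ^ 2 + 4 * xi t / t ^ 3.

Lemma in_interval_locally t : in_interval a b t -> locally t (in_interval a b).
Proof.
intros [Ha Hb]; apply filter_and.
- now apply (open_Rbar_gt' t a).
- now apply (open_Rbar_lt' t b).
Qed.

Lemma is_derive_lapse t : in_interval a b t -> is_derive lapse t (lapse' t).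
Proof.
intros Ht; pose proof (t_pos t Ht); pose proof (xi_smooth 1 t Ht) as H1.
unfold lapse, lapse'; auto_derive.
- repeat split; [exact H1 | lra].
- change (Derive (fun s => xi s) t) with (Derive xi t); field; lra.
Qed.

Lemma is_derive_lapse' t : in_interval a b t -> is_derive lapse' t (lapse'' t).
Proof.
intros Ht; pose proof (t_pos t Ht).
pose proof (xi_smooth 1 t Ht) as H1; pose proof (xi_smooth 2 t Ht) as H2.
unfold lapse', lapse''; auto_derive.
- repeat split; try exact H1; try exact H2; try lra.
  apply Rgt_not_eq; nra.
- change (Derive (fun s => xi s) t) with (Derive xi t).
  change (Derive_n xi 2 t) with (Derive (fun s => Derive xi s) t); field; lra.
Qed.

(** [auto_derive] leaves [Derive] applied to eta-expanded functions. *)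
Lemma Derive_lapse t : in_interval a b t -> Derive (fun s => lapse s) t = lapse' t.
Proof. intros Ht; apply is_derive_unique, is_derive_lapse, Ht. Qed.

Lemma Derive_lapse' t : in_interval a b t -> Derive (fun s => lapse' s) t = lapse'' t.
Proof. intros Ht; apply is_derive_unique, is_derive_lapse', Ht. Qed.

(** The formulas are those for the metric [-dt²/F + F dz² + t² dΩ²], with [F = lapse]. *)
Definition bh_connection (q : point) (y u : vec) (k : coord) : R :=
  let t := q c_t in
  let th := q c_theta in
  match k with
  | c_t => - lapse' t / (2 * lapse t) * y c_t * u c_t
           + lapse t * lapse' t / 2 * y c_z * u c_z
           + lapse t * t * (y c_theta * u c_theta + sin th ^ 2 * y c_phi * u c_phi)
  | c_z => lapse' t / (2 * lapse t) * (y c_t * u c_z + y c_z * u c_t)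
  | c_theta => / t * (y c_t * u c_theta + y c_theta * u c_t)
               - sin th * cos th * y c_phi * u c_phi
  | c_phi => / t * (y c_t * u c_phi + y c_phi * u c_t)
             + cos th / sin th * (y c_theta * u c_phi + y c_phi * u c_theta)
  end.

Definition bh_partial (l i : coord) (q : point) : R :=
  let t := q c_t in
  let th := q c_theta in
  match l, i with
  | c_t, c_t => lapse' t / lapse t ^ 2
  | c_t, c_z => lapse' t
  | c_t, c_theta => 2 * t
  | c_t, c_phi => 2 * t * sin th ^ 2
  | c_theta, c_phi => 2 * t ^ 2 * sin th * cos th
  | _, _ => 0
  end.

Lemma partial_bh_metric (q : point) (l i j : coord) :
  in_chart a b q ->
  partial l (fun q => lower (bh_metric xi) q i j) q
  = if coord_eqb i j then bh_partial l i q else 0.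
Proof.
intros [Ht _]; pose proof (is_derive_lapse _ Ht) as HF.
pose proof (signature _ Ht) as Hs; fold (lapse (q c_t)) in Hs.
unfold partial; simpl lower.
destruct (coord_eqb i j); [| apply Derive_const].
apply is_derive_unique.
destruct l, i; unfold bh_diag, update; simpl;
  try (auto_derive; [exact I | ring]).
(* What remains are the [t]-derivatives of [g_tt] and [g_zz], the two that involve [xi]. *)
- fold (lapse (q c_t)).
  apply (is_derive_ext (fun s => - / lapse s)); [reflexivity |].
  auto_derive.
  + repeat split; [now exists (lapse' (q c_t)) | lra].
  + rewrite Derive_lapse by exact Ht; field; lra.
- exact HF.
Qed.

Lemma sin_neq0_chart (q : point) : in_chart a b q -> sin (q c_theta) <> 0.
Proof. intros [_ H]; apply Rgt_not_eq, sin_gt_0; apply H. Qed.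

(** Contracted with arbitrary vectors because the curvature applies the connection a second time, to
    the non-constant field [nabla Y U]. *)
Lemma bh_connectionE (q : point) (y u : vec) (k : coord) :
  in_chart a b q ->
  sum4 (fun i => sum4 (fun j => christoffel (bh_metric xi) q k i j * y i * u j))
  = bh_connection q y u k.
Proof.
intros Hq; pose proof (sin_neq0_chart q Hq) as Hsin.
assert (Ht := t_pos _ (proj1 Hq)); assert (Hs := signature _ (proj1 Hq)).
unfold christoffel, sum4; rewrite !(partial_bh_metric q _ _ _ Hq).
fold (lapse (q c_t)) in Hs.
destruct k; simpl; fold (lapse (q c_t)); field; repeat split; lra.
Qed.

Lemma nabla_const_bh (q : point) (y u : vec) (k : coord) :
  in_chart a b q ->
  nabla (bh_metric xi) (const_field y) (const_field u) q k = bh_connection q y u k.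
Proof.
intros Hq; unfold nabla; rewrite <- bh_connectionE by exact Hq.
unfold const_field, partial; unfold sum4 at 1; rewrite !Derive_const; ring.
Qed.

(** The derivative of the cotangent is kept as [- (sin² + cos²) / sin²], which [field] reaches
    without the Pythagorean identity. *)
Definition bh_connection_partial (l : coord) (q : point) (y u : vec) (k : coord) : R :=
  let t := q c_t in
  let th := q c_theta in
  let F := lapse t in let F' := lapse' t in let F'' := lapse'' t in
  match l, k with
  | c_t, c_t => - (F'' * F - F' ^ 2) / (2 * F ^ 2) * y c_t * u c_t
           + (F' ^ 2 + F * F'') / 2 * y c_z * u c_z
           + (F' * t + F) * (y c_theta * u c_theta + sin th ^ 2 * y c_phi * u c_phi)
  | c_t, c_z => (F'' * F - F' ^ 2) / (2 * F ^ 2) * (y c_t * u c_z + y c_z * u c_t)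
  | c_t, c_theta => - / t ^ 2 * (y c_t * u c_theta + y c_theta * u c_t)
  | c_t, c_phi => - / t ^ 2 * (y c_t * u c_phi + y c_phi * u c_t)
  | c_theta, c_t => F * t * (2 * sin th * cos th * y c_phi * u c_phi)
  | c_theta, c_theta => (sin th ^ 2 - cos th ^ 2) * y c_phi * u c_phi
  | c_theta, c_phi =>
      - (sin th ^ 2 + cos th ^ 2) / sin th ^ 2
      * (y c_theta * u c_phi + y c_phi * u c_theta)
  | _, _ => 0
  end.

(** The connection formulas hold only inside the chart; its openness along coordinate lines allows
    them to be differentiated. *)
Lemma in_chart_update (q : point) (l : coord) :
  in_chart a b q -> locally (q l) (fun s => in_chart a b (update q l s)).
Proof.
intros [Ht [H0 HPI]]; unfold in_chart, update; destruct l; simpl.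
- apply (filter_imp (in_interval a b)); [tauto | now apply in_interval_locally].
- apply filter_forall; tauto.
- apply (filter_imp (fun s => 0 < s /\ s < PI)); [tauto |].
  apply filter_and; [now apply (open_gt 0) | now apply (open_lt PI)].
- apply filter_forall; tauto.
Qed.

Lemma partial_nabla_const_bh (q : point) (l k : coord) (y u : vec) :
  in_chart a b q ->
  partial l (fun q => nabla (bh_metric xi) (const_field y) (const_field u) q k) q
  = bh_connection_partial l q y u k.
Proof.
intros Hq; unfold partial.
transitivity (Derive (fun s => bh_connection (update q l s) y u k) (q l)).
{ apply Derive_ext_loc; generalize (in_chart_update q l Hq); apply filter_imp.
  intros s; apply nabla_const_bh. }
pose proof (sin_neq0_chart q Hq) as Hsin.
assert (Ht := t_pos _ (proj1 Hq)); assert (Hs := signature _ (proj1 Hq)).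
pose proof (is_derive_lapse _ (proj1 Hq)) as H1.
pose proof (is_derive_lapse' _ (proj1 Hq)) as H2.
fold (lapse (q c_t)) in Hs.
assert (E1 : ex_derive lapse (q c_t)) by (eexists; exact H1).
assert (E2 : ex_derive lapse' (q c_t)) by (eexists; exact H2).
apply is_derive_unique.
destruct l, k; unfold bh_connection, bh_connection_partial, update; simpl;
  try (auto_derive; [exact I | ring]).
all: auto_derive; [repeat split; auto; lra |].
all: rewrite ?(Derive_lapse _ (proj1 Hq)), ?(Derive_lapse' _ (proj1 Hq)).
all: field; repeat split; lra.
Qed.

(** The coefficients are minus the usual sectional curvatures, by the sign convention for the
    curvature. One mixed coefficient suffices because [g_tt g_zz = -1] makes the Hessian of [t] on
    the [(t, z)]-plane a multiple of [h]. *)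
Lemma opR_bh (q : point) :
  in_chart a b q ->
  let t := q c_t in
  opR (bh_metric xi) q
  = block_op (bh_diag xi q) (- lapse'' t / 2) (- lapse' t / (2 * t))
      (- lapse' t / (2 * t)) (- (1 + lapse t) / t ^ 2).
Proof.
intros Hq t; apply functional_extensionality; intros x;
  apply functional_extensionality; intros y;
  apply functional_extensionality; intros u;
  apply functional_extensionality; intros k.
assert (Hb : bracket (const_field x) (const_field y) = const_field (fun _ => 0)).
{ tensor_ext; unfold bracket, const_field, partial, sum4; rewrite !Derive_const; ring. }
assert (Hn : forall x y k,
  nabla (bh_metric xi) (const_field x)
    (nabla (bh_metric xi) (const_field y) (const_field u)) q k
  = sum4 (fun i => x i * bh_connection_partial i q y u k)
    + bh_connection q x (bh_connection q y u) k).
{ intros x' y' k'; unfold nabla at 1.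
  rewrite bh_connectionE by exact Hq.
  f_equal.
  - unfold sum4; rewrite !partial_nabla_const_bh by exact Hq; reflexivity.
  - f_equal; apply functional_extensionality; intros i; now apply nabla_const_bh. }
unfold opR, curvature; rewrite Hb, nabla_const_bh, !Hn by exact Hq.
pose proof (sin_neq0_chart q Hq) as Hsin.
assert (Ht := t_pos _ (proj1 Hq)); assert (Hs := signature _ (proj1 Hq)).
fold (lapse (q c_t)) in Hs; fold t in Ht, Hs.
assert (Hc : cos (q c_theta) ^ 2 = 1 - sin (q c_theta) ^ 2)
  by (generalize (sin2_cos2 (q c_theta)); unfold Rsqr; lra).
destruct k; unfold sum4, bh_connection, bh_connection_partial, block_op, form1, form2,
  bh_diag; simpl first_block; cbv iota beta zeta; fold t; fold (lapse t).
all: field [Hc]; repeat split; lra.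
Qed.
End BlackHole.

(** * Reduction of the identities to rational functions *)

Ltac to_block_span w :=
  unfold Q;
  repeat rewrite ?wedge_block, ?dot_block_curv, ?block_span_scale, ?block_span_plus, ?block_span_minus;
  (* Where the right-hand side is the zero tensor, it too must become a span element. *)
  try rewrite <- (block_span_zero w);
  apply block_span_eq.

Theorem theorem4p2 (xi : R -> R) (a b : Rbar)
  (xi_smooth : forall (m : nat) (t : R), in_interval a b t -> ex_derive_n xi m t)
  (t_pos : forall t : R, in_interval a b t -> 0 < t)
  (signature : forall t : R, in_interval a b t -> 0 < 2 * xi t / t - 1)
  (p : point) (p_chart : in_chart a b p) :
  let M := bh_metric xi in
  let t := p c_t in
  let x := xi t in
  let x' := Derive xi t in
  let x'' := Derive_n xi 2 t in
  let g := gten M p in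
  let G := Gten M p in
  let S := ricci M p in
  let r := scalar M p in
  let 𝓡 := opR M p in
  let 𝓒 := opC M p in
  let 𝓟 := opP M p in
  let 𝓦 := opW M p in
  let 𝓚 := opK M p in
  let R := lower4 M p 𝓡 in
  let C := lower4 M p 𝓒 in
  let W := lower4 M p 𝓦 in
  let K := lower4 M p 𝓚 in
  let L1 := (x - t * x') / t ^ 3 in
  let L2 := (6 * x - 4 * t * x' + t ^ 2 * x'') / (6 * t ^ 3) in
  let L3 := (2 * x + t ^ 2 * x'') / (2 * t ^ 3) in
  let L5 := - ((2 * x' + t * x'') / (6 * t ^ 2)) in
  let L6 := - ((2 * x' + t * x'') / (3 * t ^ 2)) in
  let L7 := (3 * x + t * x' + 2 * t ^ 2 * x'') / (3 * t ^ 3) in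
  let L8 := (6 * x ^ 2 - 4 * t * x * x' - 2 * t ^ 2 * x' ^ 2
             + 4 * t ^ 2 * x * x'')
            / (t ^ 3 * (6 * x - 4 * t * x' + t ^ 2 * x'')) in
  let L9 := - 3 * t * (6 * x' * (x - t * x') + t * (t * x' + 3 * x) * x'') in
  let L10 := 6 * (- t ^ 2 * x' ^ 2 + 2 * t * x * (t * x'' - x')
                  + 3 * x ^ 2) in
  let L11 := t ^ 2 * (- t ^ 2 * x'' ^ 2 + 2 * x' ^ 2 + 2 * t * x' * x'')
             + 6 * t * x * (t * x'' - 4 * x') + 18 * x ^ 2 in
  let L12 := (- 2 * x + 4 * t * x' + t ^ 2 * x'') / (2 * t ^ 3) in
  let L13 := (3 * x ^ 2 - 2 * t * x * x' - t ^ 2 * x' ^ 2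
              + 2 * t ^ 2 * x * x'') / (3 * t ^ 6) in
  let L14 := (3 * x - 5 * t * x' - t ^ 2 * x'') / (3 * t ^ 3) in
  let L15 := (4 * t ^ 2 * x' ^ 2 + 4 * t ^ 3 * x' * x'' + t ^ 4 * x'' ^ 2)
             / (3 * t ^ 6) in
  let L16 := (2 * x - 4 * t * x' - t ^ 2 * x'') / (2 * t ^ 3) in
  let phi := - ((6 * t * x - 4 * t ^ 2 * x' + t ^ 3 * x'')
                / (t * x'' - 2 * x') ^ 2) in
  let mu := - ((6 * x * x' - 6 * t * x' ^ 2 + 3 * t * x * x''
                + t ^ 2 * x' * x'')
               / (t * (t * x'' - 2 * x') ^ 2)) in
  let eta := - (2 * (4 * x * x' ^ 2 - 4 * t * x' ^ 3 + 2 * t * x * x' * x''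
                     + t ^ 2 * x * x'' ^ 2)
                / (t ^ 3 * (t * x'' - 2 * x') ^ 2)) in
  (* i *)
  ((𝓒 · K = 𝓦 · K)%T /\ (𝓒 · K = 𝓦 · C)%T /\ (𝓒 · C = 𝓦 · C)%T) /\
  (* ii *)
  ((𝓦 · K = 𝓦 · C)%T /\ (𝓒 · K = 𝓒 · C)%T) /\
  (* iii *)
  (𝓦 · K = 𝓒 · C)%T /\
  (* iv *)
  (𝓒 · W = 𝓦 · R)%T /\
  (* v *)
  ((𝓡 · S = 𝓟 · S)%T /\ (𝓒 · S = 𝓦 · S)%T) /\
  (* vi *)
  (L3 * (𝓡 · K) = L1 * (𝓚 · C))%T /\
  (* vii *)
  ((𝓡 · W - 𝓦 · R = L5 * Q g R)%T /\ L5 = r / 12) /\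
  (* viii *)
  ((𝓒 · K - 𝓚 · C = L6 * Q g C)%T /\ L6 = r / 6) /\
  (* ix *)
  (𝓒 · R - Q S C = L7 * Q g C)%T /\
  (* x *)
  (6 * x - 4 * t * x' + t ^ 2 * x'' <> 0 ->
   (𝓡 · R - Q S R = L8 * Q g C)%T) /\
  (* xi *)
  ((L6 * L9) * (𝓡 · W) + (L1 * L10) * Q S W = (L1 * L11) * Q S R)%T /\
  (* xii *)
  (L3 * (𝓡 · K) + L12 * (𝓚 · R) + L3 * Q S K = 0)%T /\
  (* xiii *)
  ((L3 * L13) * (𝓡 · K) - (L1 ^ 2 * L2) * (𝓚 · R)
   + (L1 * L2 * L3) * Q S R = 0)%T /\
  (* xiv *)
  (L2 * (𝓒 · W) - L7 * (𝓦 · C) = L2 * Q S C)%T /\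
  (* xv *)
  ((L2 * L14) * (𝓒 · W) - (1 / (18 * t ^ 6) * L11) * (𝓦 · C)
   = L2 ^ 2 * Q S W)%T /\
  (* xvi *)
  (L15 * (𝓒 · K) + L2 ^ 2 * Q S K = (L2 * L16) * Q S C)%T /\
  (* xvii *)
  ((1 / (18 * t ^ 6) * L3 * L11) * (𝓦 · K) - (L2 ^ 2 * L14) * (𝓚 · W)
   + (L2 ^ 2 * L3) * Q S W = 0)%T /\
  (* xviii *)
  ((L1 * L3) * (𝓦 · K) + (L2 * L12) * (𝓚 · W) + (L2 * L3) * Q S K = 0)%T /\
  (* xix *)
  (t * x'' - 2 * x' <> 0 ->
   (R = phi / 2 * (S ∧ S) + mu * (g ∧ S) + eta * G)%T).

Proof.
intros M t x x' x'' g G S r 𝓡 𝓒 𝓟 𝓦 𝓚 R C W K L1 L2 L3 L5 L6 L7 L8 L9 L10 L11 L12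
  L13 L14 L15 L16 phi mu eta.
pose (w := bh_diag xi p).
assert (Ht : t <> 0) by (apply Rgt_not_eq, (t_pos t), p_chart).
assert (Hw : forall i, w i <> 0).
{ pose proof (signature t (proj1 p_chart)).
  pose proof (sin_neq0_chart a b p p_chart).
  intros i; destruct i; unfold w, bh_diag; fold t.
  - apply Ropp_neq_0_compat, Rinv_neq_0_compat; lra.
  - lra.
  - now apply pow_nonzero.
  - now apply Rmult_integral_contrapositive; split; apply pow_nonzero. }
assert (Hlow : forall i j, lower M p i j = if coord_eqb i j then w i else 0)
  by reflexivity.
assert (Hup : forall i j, upper M p i j = if coord_eqb i j then / w i else 0)
  by reflexivity.
(* [A] and [D] are [- F''/2] and [- (1 + F)/t²] in terms of [xi], and [- F'/(2t)] is [L1]. Thus [L1]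
   is the exchanging coefficient of [𝓡]; likewise [L2] is that of [𝓒] and [𝓦], and [L3] that of
   [𝓚]. *)
pose (A := - (2 * x - 2 * t * x' + t ^ 2 * x'') / t ^ 3).
pose (D := - 2 * x / t ^ 3).
assert (HR : 𝓡 = block_op w A L1 L1 D).
{ unfold 𝓡, M; rewrite (opR_bh xi a b) by assumption.
  fold t w; unfold lapse, lapse', lapse''; fold x x' x''.
  unfold A, L1, D; f_equal; field; exact Ht. }
pose proof (gten_block M p w Hlow) as Hg.
pose proof (ricci_block M p w A L1 D HR) as HS.
pose proof (scalar_block M p w A L1 D Hw Hup HR) as Hr.
pose proof (opC_block M p w A L1 D Hw Hlow Hup HR) as HC.
pose proof (opP_block M p w A L1 D HR) as HP.
pose proof (opW_block M p w A L1 D Hw Hlow Hup HR) as HW.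
pose proof (opK_block M p w A L1 D Hw Hlow Hup HR) as HK.
fold g in Hg; fold S in HS; fold r in Hr; fold 𝓒 in HC; fold 𝓟 in HP; fold 𝓦 in HW;
  fold 𝓚 in HK.
assert (HG : G = block_curv w 1 1 1).
{ unfold G, Gten; fold g; rewrite Hg, kulkarni_nomizu_block, block_curv_scale.
  apply block_curv_eq; field. }
unfold R, C, W, K; rewrite HG, Hg, HS, HR, HC, HP, HW, HK, !(lower4_block M p w), Hr
  by exact Hlow.
(* The value and derivatives of [xi] become independent variables, so that [field] sees plain
   rational functions. *)
clearbody x'' x' x t w.
unfold A, D, L1, L2, L3, L5, L6, L7, L8, L9, L10, L11, L12, L13, L14, L15, L16, phi, mu, eta.
clear - Ht.
repeat split.
all: intros.
all: try (field; assumption).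
all: try (to_block_span w; field; repeat split; assumption).
all: try (rewrite !dot_block_form; f_equal; field; assumption).
(* The Roter condition remains: three linear equations for [phi], [mu], [eta], from [h∧h], [h∧k] and
   [k∧k]. They are solvable when [S] is not a multiple of [g], that is [A <> D], and
   [A - D = - (t x'' - 2 x') / t²]. *)
rewrite !kulkarni_nomizu_block.
repeat rewrite ?block_curv_scale, ?block_curv_plus.
apply block_curv_eq; field; repeat split; assumption.
Qed.
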